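(* Let $G$ be a finite simple graph and $X_0,X_1,\dots,X_{k+1}$ a nice path decomposition of $G$. The collection $\mathcal F$ returned by the Zero Forcing Set Algorithm (described in the context) on input $G$ and this decomposition is a fort packing of $G$, i.e. a collection of pairwise disjoint forts.
   Context: A fort of $G=(V,E)$ is a set $F\subseteq V$ such that no vertex of $V\setminus F$ has exactly one neighbour in $F$; a fort packing is a collection of pairwise disjoint forts. Zero forcing: a blue vertex $u$ may force a white neighbour $v$ if $v$ is the only white vertex in $N[u]$. An arc set of a graph $H=(U,F)$ is a set of ordered pairs $(u,v)$ with $uv\in F$, not containing both $(u,v)$ and $(v,u)$; it is a forcing arc set if it is a collection of vertex-disjoint directed paths and there is a zero forcing process on $H$ starting from its sources (in-degree zero vertices), each white vertex forced by exactly one vertex and all vertices ending blue, such that $(u,v)$ is an arc exactly when $u$ forces $v$. $\overleftarrow{A}=\{(v,u):(u,v)\in A\}$. A nice path decomposition of $G$ is a sequence $X_0,\dots,X_{k+1}\subseteq V$ with (D1) every edge contained in some $X_i$, $1\le i\le k$; (D2) if $v\in X_i\cap X_j$, $i<j$, then $v\in X_s$ for $i\le s\le j$; (D3) $X_0=X_{k+1}=\emptyset$, other $X_i$ nonempty; (D4) consecutive sets differ by adding or deleting exactly one vertex; and every vertex of $G$ lies in some $X_i$. Notation: $X_i^j=\bigcup_{\tau=i}^jX_\tau$, $G(i,j)=G[X_i^j]$; $\mathsf{White}(S,H)$ is the set of vertices of $H$ still white when the zero forcing process on $H$ from initial blue set $S$ can no longer force; $\mathsf{FAS}(S,H)$ is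 a fixed canonically chosen forcing arc set representing the zero forcing process on $H$ from $S$; $\mathsf{Sources}(A,U)$ is the set of vertices of $U$ of in-degree zero in $(U,A)$. The Zero Forcing Set Algorithm: (L1) $t\leftarrow0$, $S\leftarrow\emptyset$, $A\leftarrow\emptyset$, $\mathcal F\leftarrow\emptyset$. (L2) $z\leftarrow t$, $W\leftarrow\emptyset$. (L3) while $W=\emptyset$ and $z\le k$: $z\leftarrow z+1$, $W\leftarrow\mathsf{White}(X_t\cup X_z,G(t,z))$. (L4) $A\leftarrow\overleftarrow{A}$. (L5) $S\leftarrow\mathsf{Sources}(A,X_0^t)$. (L6) if $W\ne\emptyset$: add $W$ to $\mathcal F$; $S\leftarrow S\cup X_{z-1}$; $A'\leftarrow A\cup\mathsf{FAS}(X_t\cup X_{z-1},G(t,z))$; $A\leftarrow\{(u,v)\in A':v\notin X_z\}$; $t\leftarrow z$; go to (L2). (L7) if $W=\emptyset$: $A\leftarrow A\cup\mathsf{FAS}(X_t,G(t,z))$. (L8) return $S$ and $\mathcal F$. *)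

(* Defs.v *)
From mathcomp Require Import all_boot.

Set Implicit Arguments.
Unset Strict Implicit.
Unset Printing Implicit Defensive.

(* Finite simple graphs whose vertices are taken in a fixed finite type, so   *)
(* that a graph and its induced subgraphs share one type of vertices.         *)
Record sgraph (T : finType) := SGraph {
  vset : {set T};
  adj : rel T;
  adj_sym : symmetric adj;
  adj_irr : irreflexive adj;
  adj_vset : forall x y, adj x y -> x \in vset
}.

Section Induced.
Variables (T : finType) (G : sgraph T) (U : {set T}).

Definition induced_adj : rel T :=
  [rel x y | [&& x \in U, y \in U & adj G x y]].

Fact induced_sym : symmetric induced_adj.
Proof. by move=> x y; rewrite /induced_adj /= adj_sym andbCA. Qed.

Fact induced_irr : irreflexive induced_adj.
Proof. by move=> x; rewrite /induced_adj /= adj_irr !andbF. Qed.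

Fact induced_vset x y : induced_adj x y -> x \in vset G :&: U.
Proof. by rewrite inE => /and3P[-> _ /adj_vset->]. Qed.

Definition induced : sgraph T := SGraph induced_sym induced_irr induced_vset.
End Induced.

Definition nbhd (T : finType) (H : sgraph T) (u : T) : {set T} :=
  [set w | adj H u w].

Definition closed_nbhd (T : finType) (H : sgraph T) (u : T) : {set T} :=
  u |: nbhd H u.

Definition fort (T : finType) (G : sgraph T) (F : {set T}) : Prop :=
  F \subset vset G /\
  forall v, v \in vset G :\: F -> #|nbhd G v :&: F| <> 1.

Definition fort_packing (T : finType) (G : sgraph T) (P : {set {set T}}) : Prop :=
  (forall F, F \in P -> fort G F) /\ trivIset P.

(* With B the set of blue vertices, u may force v.                            *)
Definition can_force (T : finType) (H : sgraph T) (B : {set T}) (u v : T) : bool :=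
  [&& u \in B, adj H u v & closed_nbhd H u :\: B == [set v]].

(* The list s of forces (u, v), in chronological order, is a (possibly        *)
(* unfinished) zero forcing process starting from the blue set B.             *)
Fixpoint zf_process (T : finType) (H : sgraph T) (B : {set T}) (s : seq (T * T)) : bool :=
  if s is (u, v) :: s' then can_force H B u v && zf_process H (v |: B) s'
  else true.

Definition zf_final (T : finType) (B : {set T}) (s : seq (T * T)) : {set T} :=
  B :|: [set:: [seq p.2 | p <- s]].

(* The order in which available forces are performed is irrelevant to White,  *)
(* see White_unique.                                                          *)
Definition zf_step (T : finType) (H : sgraph T) (B : {set T}) : {set T} :=
  if [pick p : T * T | can_force H B p.1 p.2] is Some p then p.2 |: B else B.

Definition White (T : finType) (S : {set T}) (H : sgraph T) : {set T} :=
  vset H :\: iter #|T| (zf_step H) S.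

Definition Sources (T : finType) (A : {set T * T}) (U : {set T}) : {set T} :=
  [set v in U | [forall u, (u, v) \notin A]].

Definition rev_arcs (T : finType) (A : {set T * T}) : {set T * T} :=
  [set p | (p.2, p.1) \in A].

Definition arc_set (T : finType) (H : sgraph T) (A : {set T * T}) : Prop :=
  (forall u v, (u, v) \in A -> adj H u v) /\
  (forall u v, ~ ((u, v) \in A /\ (v, u) \in A)).

(* Each path is given by the list of its vertices; one-vertex paths           *)
(* contribute no arc.                                                         *)
Definition disjoint_dipaths (T : finType) (H : sgraph T) (A : {set T * T}) : Prop :=
  exists ps : seq (seq T),
    [/\ uniq (flatten ps),
        {subset flatten ps <= vset H} &
        A =i flatten [seq zip p (behead p) | p <- ps]].

Definition forcing_arc_set (T : finType) (H : sgraph T) (A : {set T * T}) : Prop :=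
  [/\ arc_set H A,
      disjoint_dipaths H A &
      exists s : seq (T * T),
        [/\ zf_process H (Sources A (vset H)) s,
            zf_final (Sources A (vset H)) s = vset H &
            A =i s]].

(* A choice, for every graph H and every zero forcing set S of H, of a        *)
(* forcing arc set representing a zero forcing process on H from S.           *)
Definition FAS_choice (T : finType)
    (FAS : {set T} -> sgraph T -> {set T * T}) : Prop :=
  forall (S : {set T}) (H : sgraph T),
    S \subset vset H -> White S H = set0 ->
    forcing_arc_set H (FAS S H) /\ Sources (FAS S H) (vset H) = S.

(* The sequence is X 0, ..., X k.+1; the values X i for i > k.+1 are          *)
(* irrelevant.                                                                *)
Record nice_path_decomposition (T : finType) (G : sgraph T) (k : nat)
    (X : nat -> {set T}) : Prop := NicePathDecomposition {
  npd_sub : forall i, i <= k.+1 -> X i \subset vset G;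
  npd_edge : forall u v, adj G u v ->
    exists i, [/\ 1 <= i <= k, u \in X i & v \in X i];
  npd_convex : forall v i j s, i < j -> j <= k.+1 ->
    v \in X i -> v \in X j -> i <= s <= j -> v \in X s;
  npd_ends : X 0 = set0 /\ X k.+1 = set0;
  npd_nonempty : forall i, 1 <= i <= k -> X i <> set0;
  npd_step : forall i, i <= k -> exists v,
    (v \notin X i /\ X i.+1 = v |: X i) \/ (v \in X i /\ X i.+1 = X i :\ v);
  npd_cover : forall v, v \in vset G -> exists2 i, i <= k.+1 & v \in X i
}.

Definition bags (T : finType) (X : nat -> {set T}) (i j : nat) : {set T} :=
  \bigcup_(i <= r < j.+1) X r.

Definition Gseg (T : finType) (G : sgraph T) (X : nat -> {set T}) (i j : nat) : sgraph T :=
  induced G (bags X i j).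

Inductive zfs_line := L2 | L3 | L4 | L5 | L6 | L7 | L8.

Record zfs_state (T : finType) := ZfsState {
  st_t : nat;
  st_z : nat;
  st_W : {set T};
  st_S : {set T};
  st_A : {set T * T};
  st_F : {set {set T}}
}.

(* State after (L1); the values of z and W are overwritten by (L2).           *)
Definition zfs_init (T : finType) : zfs_line * zfs_state T :=
  (L2, ZfsState 0 0 set0 set0 set0 set0).

(* One step of the Zero Forcing Set Algorithm. A step at L3 is one evaluation *)
(* of the guard of the while loop, followed by its body if the guard holds.   *)
Definition zfs_step (T : finType) (G : sgraph T) (k : nat) (X : nat -> {set T})
    (FAS : {set T} -> sgraph T -> {set T * T})
    (c : zfs_line * zfs_state T) : zfs_line * zfs_state T :=
  let: (l, st) := c in
  let: ZfsState t z W Sb A F := st in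
  match l with
  | L2 => (L3, ZfsState t t set0 Sb A F)
  | L3 => if (W == set0) && (z <= k)
          then (L3, ZfsState t z.+1
                      (White (X t :|: X z.+1) (Gseg G X t z.+1)) Sb A F)
          else (L4, st)
  | L4 => (L5, ZfsState t z W Sb (rev_arcs A) F)
  | L5 => (L6, ZfsState t z W (Sources A (bags X 0 t)) A F)
  | L6 => if W != set0
          then let A' := A :|: FAS (X t :|: X z.-1) (Gseg G X t z) in
               (L2, ZfsState z z W (Sb :|: X z.-1)
                      [set p in A' | p.2 \notin X z] (W |: F))
          else (L7, st)
  | L7 => (L8, ZfsState t z W Sb (A :|: FAS (X t) (Gseg G X t z)) F)
  | L8 => c
  end.

Definition zfs_returns (T : finType) (G : sgraph T) (k : nat) (X : nat -> {set T})
    (FAS : {set T} -> sgraph T -> {set T * T})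
    (S : {set T}) (F : {set {set T}}) : Prop :=
  exists n st,
    [/\ iter n (zfs_step G k X FAS) (zfs_init T) = (L8, st),
        st_S st = S & st_F st = F].

(* Sanity checks: White does not depend on the order of the forces, the       *)
(* choice FAS exists, and the algorithm returns exactly one pair.             *)

Lemma can_force_stalled (T : finType) (H : sgraph T) (B B' : {set T}) u v :
  can_force H B u v -> B \subset B' -> (forall x y, ~~ can_force H B' x y) ->
  v \in B'.
Proof.
case/and3P=> uB auv /eqP Nu sBB' /(_ u v); rewrite /can_force (subsetP sBB') //.
rewrite auv /=; apply: contraNT => vB'; rewrite eqEsubset -{1}Nu setDS //.
by rewrite sub1set !inE vB' auv orbT.
Qed.

Lemma zf_step_sub (T : finType) (H : sgraph T) (B B' : {set T}) n :
  B \subset B' -> (forall x y, ~~ can_force H B' x y) ->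
  iter n (zf_step H) B \subset B'.
Proof.
move=> sBB' st; elim: n => //= n IHn; rewrite {1}/zf_step.
case: pickP => // p /can_force_stalled/(_ IHn st) p2.
by rewrite subUset sub1set p2.
Qed.

Lemma zf_iter_stalled (T : finType) (H : sgraph T) (B : {set T}) x y :
  ~~ can_force H (iter #|T| (zf_step H) B) x y.
Proof.
have grow n : (exists p, can_force H (iter n (zf_step H) B) p.1 p.2) ->
    n < #|iter n.+1 (zf_step H) B|.
  elim: n => [|n IHn] [p fp].
    rewrite /= /zf_step; case: pickP => [q _|/(_ p)]; last by rewrite [can_force _ _ _ _]fp.
    by rewrite card_gt0; apply/set0Pn; exists q.2; rewrite setU11.
  have ltn : n < #|iter n.+1 (zf_step H) B|.
    apply: IHn; move: fp => /=; rewrite {1}/zf_step.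
    by case: pickP => [q fq _|_ fp]; [exists q | exists p].
  move: ltn fp; rewrite [iter n.+2 _ _]iterS; set C := iter n.+1 _ _ => ltn fp.
  rewrite /zf_step; case: pickP => [q /and3P[_ _ /eqP Nq]|/(_ p)]; last by rewrite fp.
  have: q.2 \in closed_nbhd H q.1 :\: C by rewrite Nq set11.
  by rewrite inE cardsU1 => /andP[-> _].
apply/negP=> f; have := grow #|T| (ex_intro _ (x, y) f).
by rewrite ltnNge max_card.
Qed.

Lemma zf_process_sub (T : finType) (H : sgraph T) (B B' : {set T}) s :
  zf_process H B s -> B \subset B' -> (forall x y, ~~ can_force H B' x y) ->
  zf_final B s \subset B'.
Proof.
elim: s B => [|[u v] s IHs] B /= => [_ sB _|/andP[f ps] sB st].
  by rewrite /zf_final subUset sB; apply/subsetP=> x; rewrite inE.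
have vB' := can_force_stalled f sB st.
have := IHs _ ps; rewrite subUset sub1set vB' sB => /(_ isT st).
apply: subset_trans; apply/subsetP => x; rewrite !inE.
by case: (x \in B); case: (x == v).
Qed.

Lemma White_unique (T : finType) (H : sgraph T) (S : {set T}) s :
  zf_process H S s -> (forall u v, ~~ can_force H (zf_final S s) u v) ->
  White S H = vset H :\: zf_final S s.
Proof.
move=> ps st; rewrite /White; congr (_ :\: _); apply/eqP.
rewrite eqEsubset zf_step_sub ?subsetUl //=.
apply: (zf_process_sub ps); last exact: zf_iter_stalled.
elim: #|T| => //= n /subset_trans-> //.
by rewrite /zf_step; case: pickP => // p _; rewrite subsetUr.
Qed.

Lemma zf_process_rcons (T : finType) (H : sgraph T) (B : {set T}) s u v :
  zf_process H B (rcons s (u, v)) =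
  zf_process H B s && can_force H (zf_final B s) u v.
Proof.
elim: s B => [|[x y] s IHs] B /=.
  by rewrite andbT /zf_final (_ : [set:: _] = set0) ?setU0 //; apply/setP=> x; rewrite !inE.
rewrite IHs andbA; congr (_ && can_force _ _ _ _); apply/setP=> w.
by rewrite !inE; case: (w \in B); case: (w == y).
Qed.

Lemma zf_final_rcons (T : finType) (B : {set T}) s (u v : T) :
  zf_final B (rcons s (u, v)) = v |: zf_final B s.
Proof.
by apply/setP=> w; rewrite !inE map_rcons mem_rcons inE orbCA.
Qed.

Lemma zf_process_dom (T : finType) (H : sgraph T) (B : {set T}) s u v :
  zf_process H B s -> (u, v) \in s ->
  [/\ adj H u v, v \notin B & closed_nbhd H u \subset zf_final B s].
Proof.
elim/last_ind: s => // s [x y] IHs; rewrite zf_process_rcons zf_final_rcons mem_rcons inE.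
case/andP=> ps /and3P[_ axy /eqP Nx] /predU1P[[-> ->]|/(IHs ps)[-> -> /subset_trans->//]]; last exact: subsetUr.
have: y \in closed_nbhd H x :\: zf_final B s by rewrite Nx set11.
rewrite !inE negb_or -andbA => /and3P[yB _ _]; split=> //.
by rewrite setUC -subDset Nx.
Qed.

Lemma zip_behead_rcons (T : eqType) (p : seq T) (u v : T) :
  zip (rcons (rcons p u) v) (behead (rcons (rcons p u) v)) =
  rcons (zip (rcons p u) (behead (rcons p u))) (u, v).
Proof. by elim: p => [|x [|y p] IHp] //=; move: IHp => /= ->. Qed.

Lemma zf_process_dipaths (T : finType) (H : sgraph T) (B : {set T}) s :
  zf_process H B s ->
  exists ps : seq (seq T),
    [/\ uniq (flatten ps), flatten ps =i zf_final B s &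
        s =i flatten [seq zip p (behead p) | p <- ps]].
Proof.
elim/last_ind: s => [_|s [u v] IHs].
  exists [seq [:: x] | x <- enum B]; split.
  - by rewrite flatten_map1 map_id enum_uniq.
  - by move=> x; rewrite flatten_map1 map_id mem_enum !inE orbF.
  by elim: (enum B) => //= x r IHr.
rewrite zf_process_rcons zf_final_rcons => /andP[Ps f].
have [ps [ups eps es]] := IHs Ps.
case/and3P: f => uB auv /eqP Nu.
have /setDP[_ vB] : v \in closed_nbhd H u :\: zf_final B s by rewrite Nu set11.
have /flattenP[p pps up] : u \in flatten ps by rewrite eps.
have [r pr] : exists r, p = rcons r u.
  case/splitPr: up pps => p1 [|w p2] pps; first by exists p1; rewrite cats1.
  case/negP: vB; suff us : (u, w) \in s.
    have [_ _ /subsetP->//] := zf_process_dom Ps us.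
    by rewrite !inE auv orbT.
  rewrite es; apply/flattenP; exists (zip (p1 ++ [:: u, w & p2]) (behead (p1 ++ [:: u, w & p2]))).
    by apply/mapP; exists (p1 ++ [:: u, w & p2]).
  elim: {pps} p1 => [|x [|y p1] IH] /=; first exact: mem_head.
    by rewrite !inE eqxx orbT.
  by rewrite inE IH orbT.
have pe := perm_to_rem pps.
exists (rcons p v :: rem p ps).
have pfe : perm_eq (flatten ps) (p ++ flatten (rem p ps)) by apply: (perm_flatten pe).
have pv : perm_eq (flatten (rcons p v :: rem p ps)) (v :: flatten ps).
  by rewrite /= cat_rcons perm_catC /= perm_cons perm_sym (permPl pfe) perm_catC.
split.
- by rewrite (perm_uniq pv) /= ups eps vB.
- by move=> x; rewrite (perm_mem pv) !inE eps !inE.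
move=> x; rewrite mem_rcons inE es /= pr zip_behead_rcons -pr mem_cat mem_rcons inE -orbA.
congr (_ || _).
by rewrite (perm_mem (perm_flatten (perm_map (fun p => zip p (behead p)) pe))) /= mem_cat.
Qed.

Lemma FAS_choice_exists (T : finType) :
  exists FAS : {set T} -> sgraph T -> {set T * T}, FAS_choice FAS.
Proof.
pose run := fix run (H : sgraph T) (n : nat) (B : {set T}) {struct n} : seq (T * T) :=
 if n is n'.+1 then
  if [pick p : T * T | can_force H B p.1 p.2] is Some p
  then p :: run H n' (p.2 |: B) else [::] else [::].
have runP H n B : zf_process H B (run H n B).
  elim: n B => //= n IHn B; case: pickP => // -[u v] f /=.
  by rewrite f IHn.
have runE H n B : zf_final B (run H n B) = iter n (zf_step H) B.
  have B0 (C : {set T}) : zf_final C [::] = C.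
    by apply/setP=> x; rewrite !inE orbF.
  elim: n B => [|n IHn] B; first exact: B0.
  rewrite iterSr /= /zf_step; case: pickP => [p _|noF].
    by rewrite -IHn; apply/setP=> x; rewrite !inE; case: (x \in B); case: (x == _).
  rewrite B0; elim: n {IHn} => //= n <-; rewrite /zf_step.
  by case: pickP => // p; rewrite noF.
exists (fun S H => [set:: run H #|T| S]) => S H sSH W0.
set s := run H #|T| S; have Ps : zf_process H S s by apply: runP.
have fs : zf_final S s = vset H.
  apply/eqP; rewrite eqEsubset andbC -setD_eq0 runE -/(White S H) W0 eqxx /=.
  rewrite -runE subUset sSH; apply/subsetP=> v; rewrite inE => /mapP[[x y] xs ->].
  have [a _ _] := zf_process_dom Ps xs.
  by move: a; rewrite adj_sym; apply: adj_vset.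
have srcE : Sources [set:: s] (vset H) = S.
  apply/setP=> v; rewrite !inE; apply/andP/idP=> [[vH /forallP ns]|vS].
    move: vH; rewrite -fs !inE => /orP[//|/mapP[[x y] xs /= vy]].
    by have := ns x; rewrite inE vy xs.
  rewrite (subsetP sSH) //; split=> //; apply/forallP=> u; rewrite inE.
  by apply/negP=> /(zf_process_dom Ps)[_]; rewrite vS.
have [ps [ups eps es]] := zf_process_dipaths Ps.
split=> //; split.
- split=> u v; first by rewrite inE => /(zf_process_dom Ps)[].
  rewrite !inE => -[].
  have anti r : zf_process H S r -> (u, v) \in r -> (v, u) \notin r.
    elim/last_ind: r => // r [x y] IHr; rewrite zf_process_rcons => /andP[Pr f].
    have key a b : can_force H (zf_final S r) a b -> (b, a) \notin r /\ a != b.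
      case/and3P=> _ aab /eqP Na.
      have bB : b \in closed_nbhd H a :\: zf_final S r by rewrite Na set11.
      move: bB; rewrite inE => /andP[bB _]; split.
        apply/negP=> /(zf_process_dom Pr)[_ _ /subsetP/(_ b)].
        by rewrite !inE eqxx => /(_ isT); apply/negP; move: bB; rewrite !inE.
      by apply: contraTneq aab => ->; rewrite adj_irr.
    have [k1 k2] := key _ _ f.
    rewrite !mem_rcons !inE !xpair_eqE negb_or => /orP[/andP[/eqP-> /eqP->]|uv].
      by rewrite k1 andbT negb_and eq_sym k2.
    rewrite IHr // andbT; apply: contraNN k1 => /andP[/eqP<- /eqP<-] //.
  by move=> uv; apply/negP; apply: anti.
- exists ps; split=> // [x|x]; first by rewrite eps fs.
  by rewrite inE es.
by exists s; rewrite srcE; split=> // x; rewrite inE.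
Qed.

Lemma zfs_returns_exists (T : finType) (G : sgraph T) k X FAS :
  exists S F, @zfs_returns T G k X FAS S F.
Proof.
set step := zfs_step G k X FAS.
suff: forall m t z W S A F, t <= k.+1 -> k.+1 - t <= m ->
    exists n st, iter n step (L2, ZfsState t z W S A F) = (L8, st).
  move=> /(_ k.+1 0 0 set0 set0 set0 set0 (leq0n _)) [|n [st e]]; first by rewrite subn0.
  by exists (st_S st), (st_F st), n, st.
have loop t S A F d : forall z W, t <= z -> z <= k.+1 -> k.+1 - z <= d ->
    (W != set0 -> t < z) -> exists n z' W',
    [/\ iter n step (L3, ZfsState t z W S A F) = (L4, ZfsState t z' W' S A F),
        z' <= k.+1 & W' != set0 -> t < z'].
  elim: d => [|d IHd] z W tz zk zd Wt.
    exists 1, z, W; split=> //=.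
    by rewrite leqNgt (_ : k < z) ?andbF // -subn_eq0 -leqn0.
  case E: ((W == set0) && (z <= k)); last by exists 1, z, W; split; rewrite //= E.
  case/andP: (E) => W0 zk'.
  have [|||//|n [z' [W' [e1 e2 e3]]]] :=
    IHd z.+1 (White (X t :|: X z.+1) (Gseg G X t z.+1)).
  - exact: leqW.
  - by [].
  - by rewrite -ltnS (leq_trans _ zd) // subSS subSn.
  by exists n.+1, z', W'; split; rewrite // iterSr /= E.
elim=> [|m IHm] t z W S A F tk tm.
  have [n [z' [W' [e1 e2 e3]]]] := loop t S A F (k.+1 - t) t set0 (leqnn t) tk (leqnn _) ltac:(by rewrite eqxx).
  have W0 : W' = set0.
    apply/eqP/idPn=> /e3; move: tm; rewrite leqn0 subn_eq0 => kt.
    by rewrite ltnNge (leq_trans e2 kt).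
  by exists (4 + (n + 1)); eexists; rewrite !iterD /= e1 /= W0 eqxx.
have [n [z' [W' [e1 e2 e3]]]] := loop t S A F (k.+1 - t) t set0 (leqnn t) tk (leqnn _) ltac:(by rewrite eqxx).
have [W0|W0] := eqVneq W' set0.
  by exists (4 + (n + 1)); eexists; rewrite !iterD /= e1 /= W0 eqxx.
have [|n' [st e]] := IHm z' z' W' (Sources (rev_arcs A) (bags X 0 t) :|: X z'.-1)
   [set p in rev_arcs A :|: FAS (X t :|: X z'.-1) (Gseg G X t z') | p.2 \notin X z'] (W' |: F) e2.
  by rewrite -ltnS (leq_trans _ tm) // ltn_sub2l // (leq_trans (e3 W0)).
by exists (n' + (3 + (n + 1))), st; rewrite !iterD /= e1 /= W0.
Qed.

Lemma zfs_returns_unique (T : finType) (G : sgraph T) k X FAS S1 F1 S2 F2 :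
  @zfs_returns T G k X FAS S1 F1 -> @zfs_returns T G k X FAS S2 F2 ->
  S1 = S2 /\ F1 = F2.
Proof.
have halt n st : iter n (zfs_step G k X FAS) (L8, st) = (L8, st).
  by elim: n => //= n ->; case: st.
move=> [n [s1 [e1 <- <-]]] [m [s2 [e2 <- <-]]].
suff [->] : (L8, s1) = (L8, s2) by [].
by case: (leqP n m) => [|/ltnW] /subnK <- in e1 e2 *;
  [move: e2; rewrite iterD e1 halt | move: e1; rewrite iterD e2 halt].
Qed.

(* Main.v *)
Require Import Defs.
From mathcomp Require Import all_boot.

(** Each W collected by the algorithm consists of vertices that occur only in
    bags X i with t < i < z: they occur in some bag between t and z, but neither
    in X t nor in X z. Hence all their neighbours in G lie in G(t, z), where W is
    a fort because the forcing process has stalled. Later rounds only use bags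
    of index at least z, so the sets collected are disjoint. *)

Set Implicit Arguments.
Unset Strict Implicit.
Unset Printing Implicit Defensive.

Lemma disjoint_White (T : finType) (S : {set T}) (H : sgraph T) :
  [disjoint S & White S H].
Proof.
rewrite disjoint_sym disjoints_subset /White setDE.
apply/(subset_trans (subsetIr _ _)); rewrite setCS.
elim: #|T| => //= n /subset_trans-> //.
by rewrite /zf_step; case: pickP => // p _; rewrite subsetUr.
Qed.

(** A blue vertex with exactly one white neighbour could still force it, contradicting
    [zf_iter_stalled]. *)
Lemma fort_White (T : finType) (S : {set T}) (H : sgraph T) :
  fort H (White S H).
Proof.
split=> [|v /setDP[vH vW]]; first exact: subsetDl.
have stalled := zf_iter_stalled H S v; move: vW; rewrite /White.
set C := iter _ _ _ in stalled *; rewrite !inE vH andbT negbK => vC.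
(* As [v] is blue and all its neighbours are vertices of [H], its white neighbours are exactly the
   white part of its closed neighbourhood, the set tested by [can_force]. *)
have -> : nbhd H v :&: (vset H :\: C) = closed_nbhd H v :\: C.
  apply/setP=> w; rewrite !inE; have [->|_] := eqVneq w v.
    by rewrite vC !andbF.
  rewrite andbCA; congr (_ && _).
  by case avw: (adj H v w) => //=; move: avw; rewrite adj_sym => /adj_vset->.
move/eqP/cards1P=> [w Nv]; have /setDP[wN wC] : w \in closed_nbhd H v :\: C.
  by rewrite Nv set11.
case/negP: (stalled w); rewrite /can_force vC Nv eqxx andbT /=.
by move: wN; rewrite !inE => /predU1P[wv|//]; rewrite wv vC in wC.
Qed.

(* Edges of G at vertices of F stay inside U, so F sees no difference between
   G and the subgraph induced on U. *)
Lemma fort_induced (T : finType) (G : sgraph T) (U F : {set T}) :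
  (forall u v, v \in F -> adj G u v -> u \in U) ->
  fort (induced G U) F -> fort G F.
Proof.
move=> closedF [sFU fortF]; split.
  by apply: subset_trans sFU _; rewrite subsetIl.
move=> v /setDP[vG vF].
have sF w : w \in F -> w \in U.
  by move=> /(subsetP sFU); rewrite inE => /andP[].
case vU: (v \in U).
  have -> : nbhd G v :&: F = nbhd (induced G U) v :&: F.
    apply/setP=> w; rewrite !inE; case wF: (w \in F); last by rewrite !andbF.
    by rewrite /= /induced_adj /= vU (sF _ wF).
  by apply: fortF; rewrite !inE vF vG vU.
(* A neighbour of [v] in [F] would put [v] into [U] by [closedF]. *)
suff -> : nbhd G v :&: F = set0 by rewrite cards0.
apply/setP=> w; rewrite !inE; apply/andP=> -[avw wF].
by rewrite (closedF _ _ wF avw) in vU.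
Qed.

Lemma mem_bags (T : finType) (X : nat -> {set T}) i j v :
  reflect (exists2 r, i <= r <= j & v \in X r) (v \in bags X i j).
Proof.
rewrite /bags big_geq_mkord; apply: (iffP bigcupP) => [[r /= ir vr]|[r /andP[ir rj] vr]].
  by exists r; rewrite // ir -ltnS ltn_ord.
by exists (Ordinal (rj : r < j.+1)).
Qed.

Section SegmentFort.
Variables (T : finType) (G : sgraph T) (k : nat) (X : nat -> {set T}).
Hypothesis hX : nice_path_decomposition G k X.
Variables t z : nat.
Hypotheses (tz : t <= z) (zk : z <= k.+1).

Let W := White (X t :|: X z) (Gseg G X t z).

(** Convexity of the decomposition: [v] lies in some bag [X r] with [t <= r <= z], so an occurrence
    at [i <= t] would put it in [X t], and one at [i >= z] in [X z]; but both bags start blue. *)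
Lemma segment_White_bags v i : v \in W -> i <= k.+1 -> v \in X i -> t < i < z.
Proof.
move=> vW ik vi.
have /setUP nvtz : v \notin X t :|: X z.
  by rewrite (disjointFl (disjoint_White _ _) vW).
have /mem_bags[r /andP[tr rz] vr] : v \in bags X t z.
  by move: vW; rewrite !inE => /and3P[].
rewrite !ltnNge -negb_or; apply/negP; case/orP=> [it|zi]; apply: nvtz.
  left; have [<-//|nrt] := eqVneq r t; have lt_tr : t < r by rewrite ltn_neqAle eq_sym nrt.
  by apply: (npd_convex hX (leq_ltn_trans it lt_tr) _ vi vr); rewrite ?it ?(leq_trans rz).
right; have [<-//|nrz] := eqVneq r z; have lt_rz : r < z by rewrite ltn_neqAle nrz.
by apply: (npd_convex hX (leq_trans lt_rz zi) ik vr vi); rewrite rz.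
Qed.

Lemma fort_segment_White : fort G W.
Proof.
apply: (fort_induced (U := bags X t z)); last exact: fort_White.
(* The bag covering the edge contains [v], so its index lies strictly between [t] and [z], and [u]
   is in that bag too. *)
move=> u v vW /(npd_edge hX)[i [/andP[_ ik] ui vi]].
have /andP[ti iz] := segment_White_bags vW (leqW ik) vi.
by apply/mem_bags; exists i; rewrite // (ltnW ti) ltnW.
Qed.
End SegmentFort.

(* At L2 the variable W still holds the set collected in the previous round. *)
Definition zfs_invariant (T : finType) (G : sgraph T) (k : nat)
    (X : nat -> {set T}) (c : zfs_line * zfs_state T) : Prop :=
  let: (l, ZfsState t z W _ _ F) := c in
  [/\ t <= z <= k.+1,
      if l is L2 then True
      else W = set0 \/ W = White (X t :|: X z) (Gseg G X t z),
      fort_packing G F &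
      forall B i, B \in F -> t <= i <= k.+1 -> [disjoint B & X i]].

Lemma trivIsetU1_disjoint (T : finType) (A : {set T}) (P : {set {set T}}) :
  (forall B, B \in P -> [disjoint A & B]) -> trivIset P -> trivIset (A |: P).
Proof.
move=> dA /trivIsetP tP; apply/trivIsetP=> B C /setU1P[->|BP] /setU1P[->|CP].
- by rewrite eqxx.
- by move=> _; apply: dA.
- by move=> _; rewrite disjoint_sym dA.
exact: tP.
Qed.

(** Only L6 changes the collection, and there [W] is nonempty, hence a genuine [White] set of the
    current segment. *)
Lemma zfs_invariant_step (T : finType) (G : sgraph T) k X FAS c :
  nice_path_decomposition G k X ->
  zfs_invariant G k X c -> zfs_invariant G k X (@zfs_step T G k X FAS c).
Proof.
move=> hX; case: c => l [t z W S A F] /= [/andP[tz zk] hW [fF tF] dF].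
case: l hW => hW //=; try by split=> //; rewrite tz zk.
- by split=> //; [rewrite leqnn (leq_trans tz) | left].
- case: ifP => [/andP[_ zk']|_]; last by split=> //; rewrite tz zk.
  by split=> //; [rewrite leqW | right].
case: ifP => [/negbTE W0|_]; last by split=> //; rewrite tz zk.
case: hW => [W0'|hW]; first by rewrite W0' eqxx in W0.
have inW v i : v \in W -> i <= k.+1 -> v \in X i -> t < i < z.
  by rewrite hW; apply: (segment_White_bags hX).
split=> //.
- by rewrite leqnn zk.
- split=> [B /setU1P[->|/fF//]|]; first by rewrite hW; apply: (fort_segment_White hX).
  (* Each vertex of [W] lies in a bag of index at least [t], and the earlier forts avoid all of
     those. *)
  apply: trivIsetU1_disjoint => // B BF; rewrite disjoints_subset.
  apply/subsetP=> v vW; rewrite inE.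
  have /mem_bags[r /andP[tr rz] vr] : v \in bags X t z.
    by move: vW; rewrite hW !inE => /and3P[].
  by rewrite (disjointFl (dF _ r BF _) vr) // tr (leq_trans rz).
(* The counter [t] becomes [z]: earlier forts already avoid these bags since [t <= z], and [W] meets
   only bags before [z]. *)
move=> B i /setU1P[->|BF] /andP[zi ik]; last by apply: dF; rewrite ?(leq_trans tz).
rewrite disjoints_subset; apply/subsetP=> v vW; rewrite inE.
by apply/negP=> /(inW _ _ vW ik); rewrite [i < z]ltnNge zi andbF.
Qed.

Theorem theorem4p9 (T : finType) (G : sgraph T) (k : nat) (X : nat -> {set T})
    (hX : nice_path_decomposition G k X)
    (FAS : {set T} -> sgraph T -> {set T * T}) (hFAS : FAS_choice FAS)
    (S : {set T}) (F : {set {set T}}) (hret : zfs_returns G k X FAS S F) :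
  fort_packing G F.
Proof.
have [n [st [eq_st _ <-]]] := hret.
have : zfs_invariant G k X (iter n (zfs_step G k X FAS) (zfs_init T)).
  elim: n {eq_st} => [|n IHn]; last exact: zfs_invariant_step.
  split=> //; last by move=> B i; rewrite inE.
  by split=> [B|]; [rewrite inE | apply/trivIsetP=> B C; rewrite inE].
by rewrite eq_st; case: st {eq_st} => t z W Sb A P [].
Qed.
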